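(* Let $H$ be a finite-dimensional complex Hilbert space and let $|\Psi\rangle\in H\otimes H\otimes H$ be a Frobenius state. Then there exist effects $\langle\Phi|:H\otimes H\to\mathbb C$ and $\langle\xi|:H\to\mathbb C$ such that the maps $$\delta=(1_H\otimes1_H\otimes\langle\Phi|)\circ(|\Psi\rangle\otimes1_H):H\to H\otimes H,\qquad \epsilon=\langle\xi|:H\to\mathbb C,$$ $$\mu=(1_H\otimes\langle\Phi|)\circ(\delta\otimes1_H):H\otimes H\to H,\qquad \eta=(\langle\xi|\otimes\langle\xi|\otimes1_H)|\Psi\rangle:\mathbb C\to H$$ (so that $\mu$ is $|\Psi\rangle$ with two of its outputs turned into inputs using $\langle\Phi|$) form a commutative Frobenius algebra $(\mu,\eta,\delta,\epsilon)$ on $H$.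
   Context: A commutative Frobenius algebra on $H$ consists of linear maps $\mu:H\otimes H\to H$, $\eta:\mathbb C\to H$, $\delta:H\to H\otimes H$, $\epsilon:H\to\mathbb C$ such that $(\mu,\eta)$ is a commutative monoid, $(\delta,\epsilon)$ is a cocommutative comonoid and $(1\otimes\mu)(\delta\otimes1)=\delta\mu=(\mu\otimes1)(1\otimes\delta)$. Vectors in $K$ are identified with linear maps $\mathbb C\to K$; an effect on $K$ is a linear functional $K\to\mathbb C$; normalisation of states is ignored. A symmetric vector $|\Psi\rangle\in H^{\otimes3}$ (invariant under permutations of the tensor factors) is a Frobenius state if there exist effects $\langle\Phi|:H\otimes H\to\mathbb C$, $\langle\xi|:H\to\mathbb C$ such that: (1) (strong SLOCC-maximality) with $|\beta\rangle=(\langle\xi|\otimes1\otimes1)|\Psi\rangle\in H\otimes H$, one has $(1_H\otimes\langle\Phi|)(|\beta\rangle\otimes1_H)=1_H$; (2) (strong symmetry) the vector $(1\otimes1\otimes\langle\Phi|\otimes1\otimes1)(|\Psi\rangle\otimes|\Psi\rangle)\in H^{\otimes4}$ is invariant under all permutations of the four tensor factors. *)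

(* Defs.v *)
From HB Require Import structures.
From mathcomp Require Import all_boot all_order all_fingroup all_algebra.
From mathcomp Require Import sesquilinear reals complex.

Set Implicit Arguments.
Unset Strict Implicit.
Unset Printing Implicit Defensive.

Import GRing.Theory.
Local Open Scope ring_scope.

Declare Scope tensor_scope.
Delimit Scope tensor_scope with T.
Local Open Scope tensor_scope.

Reserved Notation "U \ox V" (at level 40, left associativity).
Reserved Notation "u \ot v" (at level 40, left associativity).
Reserved Notation "f \om g" (at level 40, left associativity).

(* Finite-dimensional model U (x) V = Hom(U^*, V), in which u (x) v is the    *)
(* map phi |-> phi(u) v. Lemmas tliftE and tensor_ext below are the universal *)
(* property of the tensor product: existence and uniqueness of the linear     *)
(* factorisation of a bilinear map.                                           *)
Definition tensor (K : fieldType) (U V : vectType K) : vectType K :=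
  'Hom('Hom(U, K^o), V).

Notation "U \ox V" := (tensor U V) : type_scope.
Notation "U \ox V" := (tensor U V) : tensor_scope.

Definition pure (K : fieldType) (U V : vectType K) (u : U) (v : V) : U \ox V :=
  linfun (fun phi : 'Hom(U, K^o) => (phi u : K) *: v).

Notation "u \ot v" := (pure u v) : tensor_scope.

Definition bilin (K : fieldType) (U V W : vectType K) (b : U -> V -> W) : Prop :=
  (forall v, linear (b^~ v)) /\ (forall u, linear (b u)).

(* The linear map induced by a bilinear b; a junk value for other b.          *)
Definition tlift (K : fieldType) (U V W : vectType K) (b : U -> V -> W) :
    'Hom(U \ox V, W) :=
  linfun (fun t : 'Hom('Hom(U, K^o), V) =>
    \sum_(i < \dim {:U}) b (vbasis {:U})`_i (t (linfun (coord (vbasis {:U}) i : U -> K^o)))).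

Section TensorTheory.
Variable K : fieldType.
Implicit Types U V W : vectType K.

Lemma linfunE U W (f : U -> W) : linear f -> linfun f =1 f.
Proof.
move=> lf x.
pose m := GRing.isLinear.Build K U W *:%R f lf.
pose F : {linear U -> W} := HB.pack f m.
exact: (lfunE F).
Qed.

Lemma pureE U V (u : U) (v : V) (phi : 'Hom(U, K^o)) :
  (u \ot v : 'Hom('Hom(U, K^o), V)) phi = (phi u : K) *: v.
Proof.
rewrite linfunE // => a p q.
by rewrite add_lfunE scale_lfunE scalerDl scalerA.
Qed.

Lemma pure_bilin U V : bilin (@pure K U V).
Proof.
split=> [v a x y|u a x y]; apply/lfunP=> phi.
  by rewrite add_lfunE scale_lfunE !pureE linearP scalerDl scalerA.
by rewrite add_lfunE scale_lfunE !pureE scalerDr !scalerA mulrC.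
Qed.

Lemma pureZl U V a (u : U) (v : V) : (a *: u) \ot v = a *: (u \ot v).
Proof. by apply/lfunP=> phi; rewrite scale_lfunE !pureE linearZ scalerA. Qed.

Lemma pureZr U V a (u : U) (v : V) : u \ot (a *: v) = a *: (u \ot v).
Proof.
by apply/lfunP=> phi; rewrite scale_lfunE !pureE !scalerA mulrC.
Qed.

Lemma tlift_linear U V W (b : U -> V -> W) : (forall u, linear (b u)) ->
  linear (fun t : 'Hom('Hom(U, K^o), V) =>
    \sum_(i < \dim {:U}) b (vbasis {:U})`_i (t (linfun (coord (vbasis {:U}) i : U -> K^o)))).
Proof.
move=> lb a s t; rewrite scaler_sumr -big_split; apply: eq_bigr => i _ /=.
by rewrite add_lfunE scale_lfunE lb.
Qed.

Lemma tliftE U V W (b : U -> V -> W) : bilin b ->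
  forall u v, tlift b (u \ot v) = b u v.
Proof.
case=> lbl lbr u v; rewrite /tlift linfunE; last exact: tlift_linear.
pose m := GRing.isLinear.Build K U W *:%R (b^~ v) (lbl v).
pose F : {linear U -> W} := HB.pack (b^~ v) m.
rewrite [in RHS](coord_vbasis (memvf u)).
rewrite -[RHS]/(F _) linear_sum; apply: eq_bigr => i _.
rewrite linearZ /= pureE linfunE; last by move=> a x y; rewrite linearP.
pose m' := GRing.isLinear.Build K V W *:%R (b (vbasis {:U})`_i) (lbr _).
pose G : {linear V -> W} := HB.pack (b (vbasis {:U})`_i) m'.
by rewrite -[LHS]/(G _) linearZ.
Qed.

Lemma pure_sum U V (t : U \ox V) :
  t = \sum_(i < \dim {:U}) (vbasis {:U})`_i \ot
    (t : 'Hom('Hom(U, K^o), V)) (linfun (coord (vbasis {:U}) i : U -> K^o)).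
Proof.
have lc i : linear (coord (vbasis {:U}) i : U -> K^o).
  by move=> a x y; rewrite linearP.
apply/lfunP=> phi; rewrite sum_lfunE.
transitivity ((t : 'Hom('Hom(U, K^o), V)) (\sum_(i < \dim {:U}) (phi (vbasis {:U})`_i : K) *:
    linfun (coord (vbasis {:U}) i : U -> K^o))).
  congr (fun_of_lfun _ _); apply/lfunP=> u; rewrite sum_lfunE.
  rewrite {1}(coord_vbasis (memvf u)) linear_sum; apply: eq_bigr => i _.
  by rewrite scale_lfunE linearZ linfunE //=; apply: mulrC.
by rewrite linear_sum; apply: eq_bigr => i _; rewrite linearZ pureE.
Qed.

Lemma tensor_ext U V W (f g : 'Hom(U \ox V, W)) :
  (forall u v, f (u \ot v) = g (u \ot v)) -> f = g.
Proof.
move=> fg; apply/lfunP=> t; rewrite (pure_sum t) !linear_sum.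
by apply: eq_bigr => i _; apply: fg.
Qed.

End TensorTheory.

Section TensorMaps.
Variable K : fieldType.
Implicit Types U V W : vectType K.

Definition tmap U V U' V' (f : 'Hom(U, U')) (g : 'Hom(V, V')) :
    'Hom(U \ox V, U' \ox V') :=
  tlift (fun u v => f u \ot g v).

Definition assoc U V W : 'Hom((U \ox V) \ox W, U \ox (V \ox W)) :=
  tlift (fun (t : U \ox V) w => tlift (fun u v => u \ot (v \ot w)) t).

Definition assocV U V W : 'Hom(U \ox (V \ox W), (U \ox V) \ox W) :=
  tlift (fun u (t : V \ox W) => tlift (fun v w => (u \ot v) \ot w) t).

Definition lunit V : 'Hom((K^o : vectType K) \ox V, V) :=
  tlift (fun (a : K^o) (v : V) => (a : K) *: v).

Definition lunitV V : 'Hom(V, (K^o : vectType K) \ox V) :=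
  linfun (fun v : V => (1 : K^o) \ot v).

Definition runit V : 'Hom(V \ox (K^o : vectType K), V) :=
  tlift (fun (v : V) (a : K^o) => (a : K) *: v).

Definition swap U V : 'Hom(U \ox V, V \ox U) :=
  tlift (fun (u : U) (v : V) => v \ot u).

Definition ket V (v : V) : 'Hom(K^o, V) := linfun (fun a : K^o => (a : K) *: v).

End TensorMaps.

Notation "f \om g" := (tmap f g) : tensor_scope.
Arguments assoc {K U V W}.
Arguments assocV {K U V W}.
Arguments lunit {K V}.
Arguments lunitV {K V}.
Arguments runit {K V}.
Arguments swap {K U V}.

Lemma tmapE (K : fieldType) (U V U' V' : vectType K)
    (f : 'Hom(U, U')) (g : 'Hom(V, V')) u v : (f \om g) (u \ot v) = f u \ot g v.
Proof.
rewrite tliftE //; have [bl br] := pure_bilin U' V'.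
by split=> [y a x x'|x a y y']; rewrite linearP ?bl ?br.
Qed.

Section TensorMapsTheory.
Variable K : fieldType.
Implicit Types U V W : vectType K.

Lemma ketE V (v : V) a : ket v a = (a : K) *: v.
Proof. by rewrite linfunE // => b c d; rewrite scalerDl scalerA. Qed.

Lemma assocE U V W (u : U) (v : V) (w : W) :
  assoc ((u \ot v) \ot w) = u \ot (v \ot w).
Proof.
have b3 (z : W) : bilin (fun (u : U) (v : V) => u \ot (v \ot z)).
  have [bl br] := pure_bilin V W; have [bl' br'] := pure_bilin U (V \ox W).
  by split=> [y a x x'|x a y y']; rewrite ?bl ?bl' ?br'.
rewrite tliftE; first by rewrite tliftE.
split=> [z a s t|t a y z]; first by rewrite linearP.
rewrite -scale_lfunE -add_lfunE; congr (fun_of_lfun _ t).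
apply: tensor_ext => u' v'; rewrite add_lfunE scale_lfunE !tliftE //.
by rewrite (pure_bilin V W).2 (pure_bilin _ _).2.
Qed.

Lemma assocVE U V W (u : U) (v : V) (w : W) :
  assocV (u \ot (v \ot w)) = (u \ot v) \ot w.
Proof.
have b3 (z : U) : bilin (fun (v : V) (w : W) => (z \ot v) \ot w).
  have [bl br] := pure_bilin U V; have [bl' br'] := pure_bilin (U \ox V) W.
  by split=> [y a x x'|x a y y']; rewrite ?br ?bl' ?br'.
rewrite tliftE; first by rewrite tliftE.
split=> [t a y z|z a s t]; last by rewrite linearP.
rewrite -scale_lfunE -add_lfunE; congr (fun_of_lfun _ t).
apply: tensor_ext => u' v'; rewrite add_lfunE scale_lfunE !tliftE //.
by rewrite (pure_bilin U V).1 (pure_bilin _ _).1.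
Qed.

Lemma lunitE V (a : K^o) (v : V) : lunit (a \ot v) = (a : K) *: v.
Proof.
rewrite tliftE //; split=> [w b x y|x b w w'].
  by rewrite scalerDl scalerA.
by rewrite scalerDr !scalerA mulrC.
Qed.

Lemma runitE V (a : K^o) (v : V) : runit (v \ot a) = (a : K) *: v.
Proof.
rewrite tliftE //; split=> [x b w w'|w b x y].
  by rewrite scalerDr !scalerA mulrC.
by rewrite scalerDl scalerA.
Qed.

Lemma lunitVE V (v : V) : lunitV v = (1 : K^o) \ot v.
Proof. by rewrite linfunE // => a x y; rewrite (pure_bilin _ _).2. Qed.

Lemma swapE U V (u : U) (v : V) : swap (u \ot v) = v \ot u.
Proof.
by rewrite tliftE //; have [bl br] := pure_bilin V U; split=> x a y z; rewrite ?br ?bl.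
Qed.

End TensorMapsTheory.

Section TensorPower.
Variables (K : fieldType) (H : vectType K).

Fixpoint tpow (n : nat) : vectType K :=
  match n with
  | 0 => K^o
  | n'.+1 => match n' with 0 => H | _ => tpow n' \ox H end
  end.

Fixpoint tpure (n : nat) : {ffun 'I_n -> H} -> tpow n :=
  match n return {ffun 'I_n -> H} -> tpow n with
  | 0 => fun _ => (1 : K^o)
  | n'.+1 => fun v =>
      match n' return tpow n' -> tpow n'.+1 with
      | 0 => fun _ => v ord_max
      | _ => fun t => t \ot v ord_max
      end (tpure [ffun i => v (lift ord_max i)])
  end.

Definition ffsnoc (n : nat) (v : {ffun 'I_n -> H}) (x : H) :
    {ffun 'I_n.+1 -> H} :=
  [ffun i => if unlift ord_max i is Some j then v j else x].

(* The linear map on the n-th tensor power induced by an n-linear f.          *)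
Fixpoint mlift (W : vectType K) (n : nat) :
    ({ffun 'I_n -> H} -> W) -> 'Hom(tpow n, W) :=
  match n return ({ffun 'I_n -> H} -> W) -> 'Hom(tpow n, W) with
  | 0 => fun f => ket (f [ffun=> 0])
  | n'.+1 => fun f =>
      match n' return (H -> 'Hom(tpow n', W)) -> 'Hom(tpow n'.+1, W) with
      | 0 => fun g => linfun (fun x : H => g x (1 : K^o))
      | _ => fun g => tlift (fun t x => g x t)
      end (fun x => mlift (fun v => f (ffsnoc v x)))
  end.

(* The operator permuting the tensor factors: see perm_opE.                   *)
Definition perm_op (n : nat) (s : 'S_n) : 'End(tpow n) :=
  mlift (fun v => tpure [ffun i => v (s i)]).

Definition symmetric_tensor (n : nat) (t : tpow n) : Prop :=
  forall s : 'S_n, perm_op s t = t.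

Definition ffset (n : nat) (v : {ffun 'I_n -> H}) (i : 'I_n) (x : H) :=
  [ffun j => if j == i then x else v j].

Definition multilin (W : vectType K) (n : nat) (f : {ffun 'I_n -> H} -> W) :=
  forall (v : {ffun 'I_n -> H}) i, linear (fun x => f (ffset v i x)).

Lemma ffsnoc_set n (v : {ffun 'I_n -> H}) i y x :
  ffsnoc (ffset v i y) x = ffset (ffsnoc v x) (lift ord_max i) y.
Proof.
apply/ffunP=> j; rewrite !ffunE; case: unliftP => [k ->|->].
  by rewrite ffunE (inj_eq lift_inj).
by rewrite eq_liftF.
Qed.

Lemma ffsnoc_max n (v : {ffun 'I_n -> H}) x y :
  ffsnoc v x = ffset (ffsnoc v y) ord_max x.
Proof.
apply/ffunP=> j; rewrite !ffunE; case: unliftP => [k ->|->]; last by rewrite eqxx.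
by rewrite eq_sym eq_liftF.
Qed.

Lemma ffsnocK n (v : {ffun 'I_n.+1 -> H}) :
  ffsnoc [ffun i => v (lift ord_max i)] (v ord_max) = v.
Proof.
by apply/ffunP=> j; rewrite !ffunE; case: unliftP => [k ->|->]; rewrite ?ffunE.
Qed.

Lemma multilin_snoc (W : vectType K) n (f : {ffun 'I_n.+1 -> H} -> W) x :
  multilin f -> multilin (fun v => f (ffsnoc v x)).
Proof. by move=> mf v i a y z; rewrite !ffsnoc_set mf. Qed.

Lemma mliftS2 (W : vectType K) n (f : {ffun 'I_n.+2 -> H} -> W) :
  mlift f = tlift (fun t x => mlift (fun v => f (ffsnoc v x)) t).
Proof. by []. Qed.

Lemma tpureS2 n (v : {ffun 'I_n.+2 -> H}) :
  tpure v = tpure [ffun i => v (lift ord_max i)] \ot v ord_max.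
Proof. by []. Qed.

Lemma tpure1 (v : {ffun 'I_1 -> H}) : tpure v = v ord_max.
Proof. by []. Qed.

Lemma mlift1 (W : vectType K) (f : {ffun 'I_1 -> H} -> W) :
  mlift f = linfun (fun x : H => mlift (fun v => f (ffsnoc v x)) (1 : K^o)).
Proof. by []. Qed.

Lemma tpow_ext (W : vectType K) n (f g : 'Hom(tpow n, W)) :
  (forall v, f (tpure v) = g (tpure v)) -> f = g.
Proof.
elim: n W f g => [|[|n] IH] W f g fg.
- apply/lfunP=> a; have <- : (a : K) *: (1 : K^o) = a by apply: mulr1.
  by rewrite !linearZ; congr (_ *: _); apply: (fg [ffun=> 0]).
- apply/lfunP=> x; have := fg [ffun=> x].
  by rewrite tpure1 ffunE.
- apply: tensor_ext => t x.
  have lp (h : 'Hom(tpow n.+2, W)) :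
      linear (fun t : tpow n.+1 => h (t \ot x)).
    by move=> a s s'; rewrite (pure_bilin _ _).1 linearP.
  have: linfun (fun t : tpow n.+1 => f (t \ot x)) =
        linfun (fun t : tpow n.+1 => g (t \ot x)).
    apply: IH => v; rewrite !linfunE //.
    have := fg (ffsnoc v x); rewrite tpureS2 ffunE unlift_none.
    suff -> : [ffun i => ffsnoc v x (lift ord_max i)] = v by [].
    by apply/ffunP=> i; rewrite !ffunE liftK.
  by move/lfunP/(_ t); rewrite !linfunE.
Qed.

Lemma mliftE (W : vectType K) n (f : {ffun 'I_n -> H} -> W) : multilin f ->
  forall v, mlift f (tpure v) = f v.
Proof.
elim: n f => [|[|n] IH] f mf v.
- by rewrite /= ketE scale1r; congr f; apply/ffunP; case.
- have e x : mlift (fun v => f (ffsnoc v x)) (1 : K^o) = f (ffset v ord_max x).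
    rewrite /= ketE scale1r; congr f; apply/ffunP=> j; rewrite !ffunE.
    by rewrite (ord1 j) /= (_ : 0 = ord_max) ?unlift_none //; apply: val_inj.
  rewrite mlift1 tpure1 linfunE; last by move=> a x y; rewrite !e mf.
  by rewrite e; congr f; apply/ffunP=> j; rewrite !ffunE !ord1; case: eqP.
rewrite mliftS2 tpureS2 tliftE; first by rewrite IH ?ffsnocK //; apply: multilin_snoc.
split=> [x a s t|t a x y]; first by rewrite linearP.
rewrite -scale_lfunE -add_lfunE; congr (fun_of_lfun _ t).
apply: (@tpow_ext W n.+1) => {t}w; rewrite add_lfunE scale_lfunE !IH; try exact: multilin_snoc.
by rewrite (ffsnoc_max w (a *: x + y) 0) (ffsnoc_max w x 0) (ffsnoc_max w y 0) mf.
Qed.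

Lemma tpure_multilin n : multilin (@tpure n).
Proof.
elim: n => [v []|[|n] IH v i a x y] //.
  by rewrite !tpure1 !ffunE (ord1 i) (ord1 ord_max) eqxx.
rewrite !tpureS2; have [bl br] := pure_bilin (tpow n.+1) H.
case: (unliftP ord_max i) => [k|] ->.
  have e z : [ffun j => ffset v (lift ord_max k) z (lift ord_max j)] =
             ffset [ffun j => v (lift ord_max j)] k z.
    by apply/ffunP=> j; rewrite !ffunE (inj_eq lift_inj).
  by rewrite !e IH bl !ffunE eq_liftF.
have e z : [ffun j => ffset v ord_max z (lift ord_max j)] =
           [ffun j => v (lift ord_max j)].
  by apply/ffunP=> j; rewrite !ffunE eq_sym eq_liftF.
by rewrite !e !ffunE eqxx br.
Qed.

Lemma perm_opE n (s : 'S_n) (v : {ffun 'I_n -> H}) :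
  perm_op s (tpure v) = tpure [ffun i => v (s i)].
Proof.
rewrite /perm_op (mliftE (f := fun v => tpure [ffun i => v (s i)])) //.
move=> {}v i a x y.
have e z : [ffun j => ffset v i z (s j)] =
           ffset [ffun j => v (s j)] ((s^-1)%g i) z.
  by apply/ffunP=> j; rewrite !ffunE -(inj_eq (@perm_inj _ s) j) permKV.
by rewrite !e tpure_multilin.
Qed.

End TensorPower.

Section Frobenius.
Variables (K : fieldType) (H : vectType K).

Record comm_monoid (mu : 'Hom(H \ox H, H)) (eta : 'Hom(K^o, H)) : Prop := {
  mu_assoc : (mu \o (mu \om \1) = mu \o (\1 \om mu) \o assoc)%VF;
  mu_unitl : (mu \o (eta \om \1) = lunit)%VF;
  mu_unitr : (mu \o (\1 \om eta) = runit)%VF;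
  mu_comm : (mu \o swap = mu)%VF
}.

Record cocomm_comonoid (delta : 'Hom(H, H \ox H)) (epsilon : 'Hom(H, K^o)) :
    Prop := {
  delta_coassoc : (assoc \o (delta \om \1) \o delta = (\1 \om delta) \o delta)%VF;
  delta_counitl : (lunit \o (epsilon \om \1) \o delta = \1)%VF;
  delta_counitr : (runit \o (\1 \om epsilon) \o delta = \1)%VF;
  delta_cocomm : (swap \o delta = delta)%VF
}.

Record comm_frobenius_algebra (mu : 'Hom(H \ox H, H)) (eta : 'Hom(K^o, H))
    (delta : 'Hom(H, H \ox H)) (epsilon : 'Hom(H, K^o)) : Prop := {
  frob_monoid : comm_monoid mu eta;
  frob_comonoid : cocomm_comonoid delta epsilon;
  frob_law_r : ((\1 \om mu) \o assoc \o (delta \om \1) = delta \o mu)%VF;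
  frob_law_l : ((mu \om \1) \o assocV \o (\1 \om delta) = delta \o mu)%VF
}.

(* The bracketing of the triple and fourfold tensor products is to the left,  *)
(* hence the explicit associators and unitors below.                          *)
Variables (Psi : H \ox H \ox H) (Phi : 'Hom(H \ox H, K^o)) (xi : 'Hom(H, K^o)).

(* (<xi| (x) 1 (x) 1) |Psi>                                                   *)
Definition state_beta : H \ox H :=
  ((lunit \om \1) \o (xi \om \1 \om \1))%VF Psi.

Definition strongly_SLOCC_maximal : Prop :=
  (runit \o (\1 \om Phi) \o assoc \o (ket state_beta \om \1) \o lunitV
   = \1 :> 'End(H))%VF.

(* (1 (x) 1 (x) <Phi| (x) 1 (x) 1) (|Psi> (x) |Psi>), the first Psi being read *)
(* in (H H) H and the second one in H (H H).                                  *)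
Definition state_square : H \ox H \ox H \ox H :=
  (assocV \o (runit \om \1) \o (\1 \om Phi \om \1) \o (assoc \om \1) \o assocV
   \o (\1 \om assoc))%VF (Psi \ot Psi).

Definition strongly_symmetric : Prop :=
  symmetric_tensor (n := 4) state_square.

(* (1 (x) 1 (x) <Phi|) (|Psi> (x) 1)                                          *)
Definition state_delta : 'Hom(H, H \ox H) :=
  (runit \o (\1 \om Phi) \o assoc \o (ket Psi \om \1) \o lunitV)%VF.

(* (1 (x) <Phi|) (delta (x) 1)                                                *)
Definition state_mu : 'Hom(H \ox H, H) :=
  (runit \o (\1 \om Phi) \o assoc \o (state_delta \om \1))%VF.

(* (<xi| (x) <xi| (x) 1) |Psi>                                                *)
Definition state_eta : 'Hom(K^o, H) :=
  (lunit \o (lunit \om \1) \o (xi \om xi \om \1) \o ket Psi)%VF.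

End Frobenius.

Definition frobenius_state (K : fieldType) (H : vectType K)
    (Psi : H \ox H \ox H) : Prop :=
  symmetric_tensor (n := 3) Psi /\
  exists (Phi : 'Hom(H \ox H, K^o)) (xi : 'Hom(H, K^o)),
    strongly_SLOCC_maximal Psi Phi xi /\ strongly_symmetric Psi Phi.

(* Main.v *)
(* The effects witnessing that Psi is a Frobenius state already work. Write    *)
(* Psi = sum_i x_i (x) y_i (x) z_i and P(a, b) = Phi (a (x) b). Strong         *)
(* SLOCC-maximality and the symmetry of Psi make P symmetric, and              *)
(* P(eta, a) = xi a; this gives the unit and counit laws. Since                *)
(* delta a = sum_i P(z_i, a) x_i (x) y_i and                                   *)
(* mu (a (x) b) = sum_i P(z_i, a) P(y_i, b) x_i, each side of associativity,   *)
(* coassociativity and the Frobenius laws is a contraction of                  *)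
(* Q = sum_(i, j) P(z_i, x_j) x_i (x) y_i (x) y_j (x) z_j with some P(-, a),   *)
(* and all these laws follow from the symmetry of Q under the exchange of its  *)
(* second and fourth factors.                                                  *)

Require Import Defs.
From mathcomp Require Import all_boot all_order all_fingroup all_algebra.
From mathcomp Require Import sesquilinear reals complex.
From mathcomp Require Import ring.

Set Implicit Arguments.
Unset Strict Implicit.
Unset Printing Implicit Defensive.

Import GRing.Theory.
Local Open Scope ring_scope.
Local Open Scope tensor_scope.

(** All maps are networks of [Psi] nodes joined by [Phi] wires. Strong SLOCC-maximality amounts to
    the resolution of the identity [SLOCC_sum]; with a single node, it yields [pairing_sym],
    [pairing_eta] and the unit and counit laws. Two joined nodes have the explicit form
    [state_square_sum], and the exchange [state_square_xwzy] carries the remaining laws: plugging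
    vectors into its last three, two or one legs gives [state_mu_assoc], [state_frobenius_mid] and
    [state_delta_coassoc]. The symmetry of [Psi] enters by choosing, at each occurrence of [mu] or
    [delta], a suitably permuted decomposition of [Psi]. *)

(** * Decompositions into pure tensors and contraction of the last factor *)

Section PureTensors.
Variable K : fieldType.
Implicit Types U V W : vectType K.

Lemma pure_suml U V (I : finType) (u : I -> U) (v : V) :
  (\sum_i u i) \ot v = \sum_i u i \ot v.
Proof.
apply/lfunP=> phi; rewrite pureE linear_sum sum_lfunE scaler_suml.
by apply: eq_bigr => i _; rewrite pureE.
Qed.

Lemma pure_sumr U V (I : finType) (u : U) (v : I -> V) :
  u \ot (\sum_i v i) = \sum_i u \ot v i.
Proof.
apply/lfunP=> phi; rewrite pureE sum_lfunE scaler_sumr.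
by apply: eq_bigr => i _; rewrite pureE.
Qed.

Lemma tensor_sum U V (t : U \ox V) :
  exists (n : nat) (u : 'I_n -> U) (v : 'I_n -> V), t = \sum_i u i \ot v i.
Proof. by exists (\dim {:U}); do 2!eexists; apply: pure_sum. Qed.

(** Decomposing twice gives a double sum; an arbitrary finite index type lets pairs serve as indices
    of a single sum. *)
Lemma tensor3_sum U V W (t : U \ox V \ox W) :
  exists (I : finType) (x : I -> U) (y : I -> V) (z : I -> W),
    t = \sum_i x i \ot y i \ot z i.
Proof.
have [m [s [w ->]]] := tensor_sum t.
set d := \dim {:U}.
have [u [v sE]] : exists (u : 'I_m -> 'I_d -> U) (v : 'I_m -> 'I_d -> V),
  forall i, s i = \sum_j u i j \ot v i j.
  by do 2!eexists; move=> i; apply: pure_sum.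
exists ('I_m * 'I_d)%type, (fun p => u p.1 p.2), (fun p => v p.1 p.2), (fun p => w p.1).
rewrite -(pair_bigA _ (fun i j => u i j \ot v i j \ot w i)) /=.
by apply: eq_bigr => i _; rewrite sE pure_suml.
Qed.

Definition contract U V (phi : 'Hom(V, K^o)) : 'Hom(U \ox V, U) :=
  (runit \o (\1 \om phi))%VF.

Arguments contract {U V}.

Lemma contractE U V (phi : 'Hom(V, K^o)) (u : U) v :
  contract phi (u \ot v) = (phi v : K) *: u.
Proof. by rewrite comp_lfunE tmapE runitE id_lfunE. Qed.

End PureTensors.

Arguments contract {K U V}.

(** * Permuting the factors in a decomposition of a symmetric tensor *)

Section SymmetricTensors.
Variables (K : fieldType) (H : vectType K).

Lemma symmetric_tensor_sum n (t : tpow H n) (I : finType) (k : I -> K)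
    (v : I -> {ffun 'I_n -> H}) (s : 'S_n) :
    symmetric_tensor t -> t = \sum_i k i *: tpure (v i) ->
  t = \sum_i k i *: tpure [ffun j => v i (s j)].
Proof.
move=> sym_t def_t; rewrite -(sym_t s) {1}def_t linear_sum.
by apply: eq_bigr => i _; rewrite linearZ /= perm_opE.
Qed.

(** Lists make the factors of a pure tensor explicit; positions beyond the list would hold 0. *)
Definition seqffun n (s : seq H) : {ffun 'I_n -> H} := [ffun i : 'I_n => s`_i].

Lemma tpure_seq3 (a b c : H) : tpure (seqffun 3 [:: a; b; c]) = a \ot b \ot c.
Proof. by rewrite !tpureS2 tpure1 !ffunE. Qed.

Lemma tpure_seq4 (a b c d : H) :
  tpure (seqffun 4 [:: a; b; c; d]) = a \ot b \ot c \ot d.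
Proof. by rewrite !tpureS2 tpure1 !ffunE. Qed.

(** A permutation operator acts on each pure summand and fixes their sum, so any decomposition may
    be traded for a permuted one. Positions count from 0. *)
Lemma tensor3_xzy (t : H \ox H \ox H) (I : finType) (x y z : I -> H) :
    symmetric_tensor (n := 3) t -> t = \sum_i x i \ot y i \ot z i ->
  t = \sum_i x i \ot z i \ot y i.
Proof.
move=> sym_t def_t.
have /(symmetric_tensor_sum (tperm (inord 1) (inord 2)) sym_t) -> :
    t = \sum_i 1 *: tpure (seqffun 3 [:: x i; y i; z i]).
  by rewrite def_t; apply: eq_bigr => i _; rewrite scale1r tpure_seq3.
apply: eq_bigr => i _; rewrite scale1r -tpure_seq3; apply: (congr1 (@tpure _ H 3)).
apply/ffunP=> j; rewrite !ffunE permE /= -!val_eqE /= !inordK //.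
by case: j => [[|[|[|]]]] //=; rewrite inordK.
Qed.

Lemma tensor3_yxz (t : H \ox H \ox H) (I : finType) (x y z : I -> H) :
    symmetric_tensor (n := 3) t -> t = \sum_i x i \ot y i \ot z i ->
  t = \sum_i y i \ot x i \ot z i.
Proof.
move=> sym_t def_t.
have /(symmetric_tensor_sum (tperm (inord 0) (inord 1)) sym_t) -> :
    t = \sum_i 1 *: tpure (seqffun 3 [:: x i; y i; z i]).
  by rewrite def_t; apply: eq_bigr => i _; rewrite scale1r tpure_seq3.
apply: eq_bigr => i _; rewrite scale1r -tpure_seq3; apply: (congr1 (@tpure _ H 3)).
apply/ffunP=> j; rewrite !ffunE permE /= -!val_eqE /= !inordK //.
by case: j => [[|[|[|]]]] //=; rewrite inordK.
Qed.

(** The outer transposition is a product of three adjacent ones. *)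
Lemma tensor3_zyx (t : H \ox H \ox H) (I : finType) (x y z : I -> H) :
    symmetric_tensor (n := 3) t -> t = \sum_i x i \ot y i \ot z i ->
  t = \sum_i z i \ot y i \ot x i.
Proof.
by move=> sym_t /(tensor3_yxz sym_t)/(tensor3_xzy sym_t)/(tensor3_yxz sym_t).
Qed.

(** The weights [k i j] are there to receive the values of [Phi] on the wire between two copies of
    [Psi]. *)
Lemma tensor4_xwzy (t : H \ox H \ox H \ox H) (I J : finType)
    (k : I -> J -> K) (x y : I -> H) (z w : J -> H) :
    symmetric_tensor (n := 4) t ->
    t = \sum_i \sum_j k i j *: (x i \ot y i \ot z j \ot w j) ->
  t = \sum_i \sum_j k i j *: (x i \ot w j \ot z j \ot y i).
Proof.
move=> sym_t def_t.
have /(symmetric_tensor_sum (tperm (inord 1) (inord 3)) sym_t) -> :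
    t = \sum_p k p.1 p.2 *: tpure (seqffun 4 [:: x p.1; y p.1; z p.2; w p.2]).
  rewrite def_t pair_bigA; apply: eq_bigr => p _.
  by rewrite tpure_seq4.
rewrite pair_bigA; apply: eq_bigr => p _; rewrite -tpure_seq4; congr (_ *: _).
apply: (congr1 (@tpure _ H 4)).
apply/ffunP=> j; rewrite !ffunE permE /= -!val_eqE /= !inordK //.
by case: j => [[|[|[|[|]]]]] //=; rewrite inordK.
Qed.

End SymmetricTensors.

(** * The structure maps as sums over a decomposition *)

Section Contractions.
Variables (K : fieldType) (H : vectType K) (Phi : 'Hom(H \ox H, K^o)).

Definition pairing (a b : H) : K := Phi (a \ot b).

Definition pair_with (b : H) : 'Hom(H, K^o) := linfun (fun a => Phi (a \ot b)).

Lemma pair_withE a b : pair_with b a = pairing a b.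
Proof.
by rewrite linfunE // => k u v; rewrite (pure_bilin _ _).1 linearP.
Qed.

(** This composite occurs in [delta], in [mu] and in the maximality condition; it plugs [b] into the
    last leg of [t] through [Phi], so all three become contractions. *)
Lemma contract_cup U (t : U \ox H) b :
  (runit \o (\1 \om Phi) \o assoc)%VF (t \ot b) = contract (pair_with b) t.
Proof.
have [n [u [v ->]]] := tensor_sum t.
rewrite pure_suml !linear_sum; apply: eq_bigr => i _.
by rewrite /= contractE pair_withE !comp_lfunE assocE tmapE runitE id_lfunE.
Qed.

Lemma pairing_suml (I : finType) (k : I -> K) (a : I -> H) b :
  pairing (\sum_i k i *: a i) b = \sum_i k i * pairing (a i) b.
Proof.
rewrite /pairing pure_suml linear_sum; apply: eq_bigr => i _.
by rewrite pureZl linearZ.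
Qed.

Lemma pairing_sumr (I : finType) (k : I -> K) a (b : I -> H) :
  pairing a (\sum_i k i *: b i) = \sum_i k i * pairing a (b i).
Proof.
rewrite /pairing pure_sumr linear_sum; apply: eq_bigr => i _.
by rewrite pureZr linearZ.
Qed.

Lemma contract_sum (U : vectType K) (I J : finType) (k : I -> J -> K) (t : I -> J -> U) v b :
  contract (pair_with b) (\sum_i \sum_j k i j *: (t i j \ot v i j)) =
    \sum_i \sum_j (k i j * pairing (v i j) b) *: t i j.
Proof.
rewrite linear_sum; apply: eq_bigr => i _; rewrite linear_sum.
by apply: eq_bigr => j _; rewrite linearZ /= contractE pair_withE scalerA.
Qed.

Variable Psi : H \ox H \ox H.
Let delta := state_delta Psi Phi.
Let mu := state_mu Psi Phi.

Lemma state_deltaE a : delta a = contract (pair_with a) Psi.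
Proof.
rewrite -contract_cup /delta /state_delta !comp_lfunE lunitVE tmapE ketE.
by rewrite id_lfunE scale1r.
Qed.

Lemma state_muE a b :
  mu (a \ot b) = contract (pair_with b) (contract (pair_with a) Psi).
Proof.
by rewrite -state_deltaE -contract_cup !comp_lfunE tmapE id_lfunE !comp_lfunE.
Qed.

Variables (I : finType) (x y z : I -> H).
Hypothesis PsiE : Psi = \sum_i x i \ot y i \ot z i.

Lemma state_delta_sum a : delta a = \sum_i pairing (z i) a *: (x i \ot y i).
Proof.
rewrite state_deltaE PsiE linear_sum; apply: eq_bigr => i _.
by rewrite /= contractE pair_withE.
Qed.

Lemma state_mu_sum a b :
  mu (a \ot b) = \sum_i (pairing (z i) a * pairing (y i) b) *: x i.
Proof.
rewrite state_muE PsiE !linear_sum; apply: eq_bigr => i _.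
by rewrite /= contractE linearZ /= contractE !pair_withE scalerA.
Qed.

Lemma state_square_sum : state_square Psi Phi =
  \sum_i \sum_j pairing (z i) (x j) *: (x i \ot y i \ot y j \ot z j).
Proof.
(* The two copies of [Psi] are expanded one at a time, to get independent indices. *)
rewrite /state_square {1}PsiE pure_suml linear_sum; apply: eq_bigr => i _.
rewrite PsiE pure_sumr linear_sum; apply: eq_bigr => j _.
rewrite /= !comp_lfunE tmapE id_lfunE assocE assocVE tmapE assocE !tmapE !id_lfunE.
by rewrite runitE pureZl linearZ /= assocVE.
Qed.

Variable xi : 'Hom(H, K^o).

Lemma state_eta_sum :
  state_eta Psi xi 1 = \sum_i ((xi (x i) : K) * (xi (y i) : K)) *: z i.
Proof.
rewrite /state_eta comp_lfunE ketE scale1r PsiE linear_sum; apply: eq_bigr => i _.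
by rewrite /= !comp_lfunE !tmapE lunitE !id_lfunE lunitE.
Qed.

(** Here [state_beta] is the sum of the [xi (x i) *: (y i \ot z i)], and the snake equation is
    evaluated at [a]. *)
Lemma SLOCC_sum : strongly_SLOCC_maximal Psi Phi xi ->
  forall a, \sum_i ((xi (x i) : K) * pairing (z i) a) *: y i = a.
Proof.
move=> maxl a; have := congr1 (fun f : 'End(H) => f a) maxl.
rewrite !comp_lfunE lunitVE tmapE ketE scale1r !id_lfunE => {2}<-.
have := contract_cup (state_beta Psi xi) a; rewrite !comp_lfunE => ->.
rewrite /state_beta PsiE !linear_sum; apply: eq_bigr => i _.
rewrite /= comp_lfunE !tmapE lunitE !id_lfunE pureZl linearZ /=.
by rewrite runitE pair_withE scalerA.
Qed.

End Contractions.

(** * The Frobenius algebra laws *)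

Section FrobeniusState.
Variables (K : fieldType) (H : vectType K) (Psi : H \ox H \ox H).
Variables (Phi : 'Hom(H \ox H, K^o)) (xi : 'Hom(H, K^o)).
Hypothesis symPsi : symmetric_tensor (n := 3) Psi.
Hypothesis maxPsi : strongly_SLOCC_maximal Psi Phi xi.
Hypothesis symQ : strongly_symmetric Psi Phi.
Local Notation P := (pairing Phi).
Local Notation delta := (state_delta Psi Phi).
Local Notation mu := (state_mu Psi Phi).
Local Notation eta := (state_eta Psi xi).

(** Expanding the left argument of each side by [SLOCC_sum], with [y] and [z] exchanged for [b],
    gives the same sum of [xi (x i) * P (z i) a * P (y i) b]. *)
Lemma pairing_sym a b : P a b = P b a.
Proof.
have [I [x [y [z def_Psi]]]] := tensor3_sum Psi.
have e1 := SLOCC_sum def_Psi maxPsi.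
have e2 := SLOCC_sum (tensor3_xzy symPsi def_Psi) maxPsi.
rewrite -{1}(e1 a) -{2}(e2 b) !pairing_suml; apply: eq_bigr => i _.
by rewrite mulrAC.
Qed.

(** This is [xi] applied to the resolution of [a] in [SLOCC_sum]. *)
Lemma pairing_eta a : P (eta 1) a = xi a.
Proof.
have [I [x [y [z def_Psi]]]] := tensor3_sum Psi.
rewrite (state_eta_sum def_Psi) pairing_suml.
rewrite -[in RHS](SLOCC_sum def_Psi maxPsi a) linear_sum.
by apply: eq_bigr => i _; rewrite linearZ /= mulrAC.
Qed.

Lemma state_mu_comm a b : mu (a \ot b) = mu (b \ot a).
Proof.
have [I [x [y [z def_Psi]]]] := tensor3_sum Psi.
rewrite (state_mu_sum _ def_Psi) (state_mu_sum _ (tensor3_xzy symPsi def_Psi)).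
by apply: eq_bigr => i _; rewrite mulrC.
Qed.

(** With [x i] in the last leg, plugging in [eta 1] produces [xi (x i)], and the resolution of the
    identity remains. *)
Lemma state_mu_unit a : mu (eta 1 \ot a) = a.
Proof.
have [I [x [y [z def_Psi]]]] := tensor3_sum Psi.
rewrite (state_mu_sum _ (tensor3_zyx symPsi def_Psi)).
rewrite -[RHS](SLOCC_sum (tensor3_xzy symPsi def_Psi) maxPsi).
by apply: eq_bigr => i _; rewrite pairing_sym pairing_eta.
Qed.

Lemma state_square_xwzy (I : finType) (x y z : I -> H) :
    Psi = \sum_i x i \ot y i \ot z i ->
  \sum_i \sum_j P (z i) (x j) *: (x i \ot y i \ot y j \ot z j)
    = \sum_i \sum_j P (z i) (x j) *: (x i \ot z j \ot y j \ot y i).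
Proof.
move=> def_Psi; rewrite -(state_square_sum Phi def_Psi).
exact: tensor4_xwzy symQ (state_square_sum Phi def_Psi).
Qed.

(** Plugging [a], [b], [c] into the last three legs of the square gives the left side; exchanging
    the second and fourth legs swaps the places of [a] and [c], which gives the right side. *)
Lemma state_mu_assoc a b c : mu (mu (a \ot b) \ot c) = mu (a \ot mu (b \ot c)).
Proof.
have [I [x [y [z def_Psi]]]] := tensor3_sum Psi.
have def_Psi' := tensor3_xzy symPsi def_Psi.
have := congr1 (fun t => contract (pair_with Phi c) (contract (pair_with Phi b)
  (contract (pair_with Phi a) t))) (state_square_xwzy def_Psi).
rewrite !contract_sum => Qabc.
rewrite (state_mu_sum Phi def_Psi a b) (state_mu_sum Phi def_Psi _ c).
rewrite (state_mu_sum Phi def_Psi' b c) (state_mu_sum Phi def_Psi' a _).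
transitivity (\sum_i \sum_j
    (P (z i) (x j) * P (z j) a * P (y j) b * P (y i) c) *: x i).
  apply: eq_bigr => i _; rewrite pairing_sumr mulr_suml scaler_suml.
  by apply: eq_bigr => j _; congr (_ *: _); ring.
rewrite {}Qabc; apply: eq_bigr => i _.
rewrite pairing_sumr mulr_sumr scaler_suml.
by apply: eq_bigr => j _; congr (_ *: _); ring.
Qed.

(** The sum is the common value of both Frobenius composites: two joined nodes, each with one input
    and one output. The exchange of legs separates the inputs, which [delta (mu (a \ot b))] plugs
    into the same node. *)
Lemma state_frobenius_mid a b (I : finType) (x y z : I -> H) :
    Psi = \sum_i x i \ot y i \ot z i ->
  delta (mu (a \ot b)) =
    \sum_i \sum_j (P (z i) (x j) * P (y i) a * P (y j) b) *: (x i \ot z j).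
Proof.
move=> def_Psi.
have := congr1 (fun t => contract (pair_with Phi b) (contract (pair_with Phi a) t))
  (state_square_xwzy def_Psi).
rewrite !contract_sum => <-.
rewrite (state_mu_sum Phi def_Psi) (state_delta_sum Phi def_Psi).
apply: eq_bigr => i _; rewrite pairing_sumr scaler_suml.
by apply: eq_bigr => j _; congr (_ *: _); ring.
Qed.

Lemma state_frobenius_r a b :
  ((\1 \om mu) \o assoc)%VF (delta a \ot b) = delta (mu (a \ot b)).
Proof.
have [I [x [y [z def_Psi]]]] := tensor3_sum Psi.
rewrite (state_frobenius_mid _ _ def_Psi).
rewrite (state_delta_sum Phi (tensor3_xzy symPsi def_Psi)).
rewrite pure_suml linear_sum; apply: eq_bigr => i _.
rewrite pureZl linearZ /= comp_lfunE assocE tmapE id_lfunE.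
(* Taking [z j] as the output leg makes [x j] meet [z i], as in the middle form up to
   [pairing_sym]. *)
rewrite (state_mu_sum Phi (tensor3_zyx symPsi def_Psi)) pure_sumr scaler_sumr.
apply: eq_bigr => j _; rewrite pureZr scalerA (pairing_sym (x j)).
by congr (_ *: _); ring.
Qed.

Lemma state_frobenius_l a b :
  ((mu \om \1) \o assocV)%VF (a \ot delta b) = delta (mu (a \ot b)).
Proof.
have [I [x [y [z def_Psi]]]] := tensor3_sum Psi.
rewrite (state_frobenius_mid _ _ def_Psi) exchange_big.
rewrite (state_delta_sum Phi (tensor3_xzy symPsi def_Psi)).
rewrite pure_sumr linear_sum; apply: eq_bigr => j _.
rewrite pureZr linearZ /= comp_lfunE assocVE tmapE id_lfunE.
rewrite (state_mu_sum Phi (tensor3_xzy symPsi def_Psi)) pure_suml scaler_sumr.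
apply: eq_bigr => i _; rewrite pureZl scalerA.
by congr (_ *: _); ring.
Qed.

(** Only [a] is plugged into the square: the exchange moves it from the node of index [j] to that of
    index [i]. The square is bracketed to the left, hence the final [assoc]. *)
Lemma state_delta_coassoc a :
  (assoc \o (delta \om \1))%VF (delta a) = (\1 \om delta)%VF (delta a).
Proof.
have [I [x [y [z def_Psi]]]] := tensor3_sum Psi.
have assoc_sum (k : I -> I -> K) (u v w : I -> I -> H) :
    assoc (\sum_i \sum_j k i j *: (u i j \ot v i j \ot w i j)) =
      \sum_i \sum_j k i j *: (u i j \ot (v i j \ot w i j)).
  rewrite linear_sum; apply: eq_bigr => i _; rewrite linear_sum.
  by apply: eq_bigr => j _; rewrite linearZ /= assocE.
have := congr1 (fun t => assoc (contract (pair_with Phi a) t))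
  (state_square_xwzy def_Psi).
rewrite !contract_sum !assoc_sum => Qa.
transitivity (\sum_i \sum_j
    (P (z i) (x j) * P (z j) a) *: (x i \ot (y i \ot y j))).
  rewrite (state_delta_sum Phi def_Psi a) linear_sum exchange_big.
  apply: eq_bigr => j _; rewrite linearZ /= comp_lfunE tmapE id_lfunE.
  rewrite (state_delta_sum Phi def_Psi) pure_suml linear_sum scaler_sumr.
  apply: eq_bigr => i _; rewrite pureZl linearZ /= assocE scalerA.
  by rewrite mulrC.
transitivity (\sum_i \sum_j
    (P (z i) (x j) * P (y i) a) *: (x i \ot (z j \ot y j))).
  exact: Qa.
rewrite (state_delta_sum Phi (tensor3_xzy symPsi def_Psi) a) linear_sum.
apply: eq_bigr => i _; rewrite linearZ /= tmapE id_lfunE.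
rewrite (state_delta_sum Phi (tensor3_zyx symPsi def_Psi)) pure_sumr scaler_sumr.
apply: eq_bigr => j _; rewrite pureZr scalerA pairing_sym.
by rewrite mulrC.
Qed.

Lemma state_delta_cocomm a : swap (delta a) = delta a.
Proof.
have [I [x [y [z def_Psi]]]] := tensor3_sum Psi.
rewrite [in LHS](state_delta_sum Phi def_Psi).
rewrite [RHS](state_delta_sum Phi (tensor3_yxz symPsi def_Psi)).
by rewrite linear_sum; apply: eq_bigr => i _; rewrite linearZ /= swapE.
Qed.

Lemma state_delta_counit a : (lunit \o (xi \om \1))%VF (delta a) = a.
Proof.
have [I [x [y [z def_Psi]]]] := tensor3_sum Psi.
rewrite (state_delta_sum Phi def_Psi) linear_sum -[RHS](SLOCC_sum def_Psi maxPsi).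
apply: eq_bigr => i _.
by rewrite linearZ /= comp_lfunE tmapE lunitE id_lfunE scalerA mulrC.
Qed.

Lemma frobenius_state_algebra : comm_frobenius_algebra mu eta delta xi.
Proof.
have muC : (mu \o swap = mu)%VF.
  by apply: tensor_ext => a b; rewrite comp_lfunE swapE state_mu_comm.
have etaE k : eta k = (k : K) *: eta 1.
  by rewrite -linearZ; congr (fun_of_lfun _ _); rewrite /GRing.scale /= mulr1.
split; first split.
- apply: tensor_ext => t c.
  (* [tensor_ext] splits off the last factor only; [t] still ranges over [H \ox H]. *)
  have [n [a [b ->]]] := tensor_sum t.
  rewrite pure_suml !linear_sum; apply: eq_bigr => i _.
  rewrite /= [LHS]comp_lfunE tmapE [RHS]comp_lfunE assocE [RHS]comp_lfunE tmapE.
  by rewrite !id_lfunE state_mu_assoc.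
- apply: tensor_ext => k a; rewrite comp_lfunE tmapE id_lfunE lunitE etaE.
  by rewrite pureZl linearZ /= state_mu_unit.
- apply: tensor_ext => a k; rewrite comp_lfunE tmapE id_lfunE runitE etaE.
  by rewrite pureZr linearZ /= state_mu_comm state_mu_unit.
- exact: muC.
- split.
  + by apply/lfunP => a; rewrite comp_lfunE state_delta_coassoc comp_lfunE.
  + by apply/lfunP => a; rewrite comp_lfunE state_delta_counit id_lfunE.
  (* The right counit law is the left one after a swap, available by cocommutativity. *)
  + apply/lfunP => a; rewrite comp_lfunE -[in LHS]state_delta_cocomm.
    rewrite -[RHS]state_delta_counit id_lfunE -!comp_lfunE.
    congr (fun_of_lfun _ _); congr (_ \o _)%VF.
    apply: tensor_ext => u v.
    by rewrite !comp_lfunE swapE !tmapE runitE lunitE.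
  + by apply/lfunP => a; rewrite comp_lfunE state_delta_cocomm.
- apply: tensor_ext => a b.
  by rewrite comp_lfunE tmapE id_lfunE state_frobenius_r comp_lfunE.
- apply: tensor_ext => a b.
  by rewrite comp_lfunE tmapE id_lfunE state_frobenius_l comp_lfunE.
Qed.

End FrobeniusState.

Theorem theorem8p3p3 (R : realType) (H : vectType R[i])
    (dotH : {dot H for Num.conj}) (Psi : H \ox H \ox H) :
  frobenius_state Psi ->
  exists (Phi : 'Hom(H \ox H, R[i]^o)) (xi : 'Hom(H, R[i]^o)),
    let delta := state_delta Psi Phi in
    let epsilon := xi in
    let mu := state_mu Psi Phi in
    let eta := state_eta Psi xi in
    comm_frobenius_algebra mu eta delta epsilon.
Proof.
move=> [symPsi [Phi [xi [maxPsi symQ]]]]; exists Phi, xi.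
exact: frobenius_state_algebra.
Qed.
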